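(* Let $(E,d)$ be a Polish space and let $(P_t)_{t\in\mathbb{R}_+}$ be a Markov semigroup on $E$. If $(P_t)_{t\in\mathbb{R}_+}$ is locally weak irreducible and satisfies ASF+ with a non-decreasing function $F\colon\mathbb{R}_+\to[0,\infty)$ such that $\|F\|_\infty<\infty$, then $(P_t)_{t\in\mathbb{R}_+}$ possesses at most one invariant probability measure.
   Context: Notation: $\mathbb{R}_+=[0,\infty)$, $\mathbb{N}=\{1,2,\dots\}$, $\mathbb{Z}_+=\{0,1,2,\dots\}$, $a\vee b=\max(a,b)$; $E$ carries its Borel $\sigma$-field; $B_R(x)=\{z\in E\colon d(z,x)<R\}$. The semigroup is given by a Markov transition function $P_t(x,A)$; $P_t\varphi(x)=\int_E\varphi(z)\,P_t(x,\mathrm{d}z)$, and $P_t\delta_x$ denotes the measure $P_t(x,\cdot)$. $\|f\|_\infty=\sup_x|f(x)|$. The semigroup is Feller if for every $t\ge0$, $P_t\varphi$ is continuous for every bounded continuous $\varphi\colon E\to\mathbb{R}$. A probability measure $\mu$ is invariant if $\int_E P_t(x,A)\,\mu(\mathrm{d}x)=\mu(A)$ for all Borel $A$ and all $t\ge 0$. $\mathscr{C}(\mu,\nu)$ is the set of all couplings of $\mu$ and $\nu$, i.e. probability measures on $E\times E$ with marginals $\mu$ and $\nu$. Local weak irreducibility: $(P_t)_{t\in\mathbb{R}_+}$ is locally weak irreducible if there exists $x_0\in E$ such that for any $R>0$ and $\varepsilon>0$ there exists $T=T(R,\varepsilon)>0$ such that for any $t\ge T$, $$\inf_{x,y\in B_R(x_0)}\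 \sup_{\Gamma\in\mathscr{C}(P_t\delta_x,P_t\delta_y)}\Gamma\big(\{(x',y')\in E\times E\colon d(x',y')\le\varepsilon\}\big)>0.$$ ASF+ (Asymptotic Strong Feller Plus Property): $(P_t)_{t\in\mathbb{R}_+}$ satisfies ASF+ with a non-decreasing function $F\colon[0,\infty)\to[0,\infty)$ if it is Feller and there exist $x_0\in E$, a non-decreasing sequence $(t_n)_{n\in\mathbb{Z}_+}$ in $\mathbb{R}_+$, and a positive sequence $(\delta_n)_{n\in\mathbb{Z}_+}$ with $\delta_n\searrow0$ as $n\to\infty$, such that for every $d$-Lipschitz continuous function $\varphi\colon E\to\mathbb{R}$ with Lipschitz constant $K>0$, $$|P_{t_n}\varphi(x)-P_{t_n}\varphi(y)|\le d(x,y)\,F\big(d(x,x_0)\vee d(y,x_0)\big)\,\big(\|\varphi\|_\infty+\delta_nK\big)$$ for every $n\in\mathbb{N}$ and $x,y\in E$. (When $\|\varphi\|_\infty=\infty$ the inequality is regarded as vacuously true, so only bounded $\varphi$ matter.) The point $x_0$ here need not be the one in the definition of local weak irreducibility. *)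

(* Defs.v *)
From HB Require Import structures.
From mathcomp Require Import all_boot all_order all_algebra.
From mathcomp Require Import all_classical all_reals all_analysis.

Set Implicit Arguments.
Unset Strict Implicit.
Unset Printing Implicit Defensive.

Import Order.TTheory GRing.Theory Num.Theory.
Import numFieldNormedType.Exports.

Local Open Scope classical_set_scope.
Local Open Scope ring_scope.

(* The library's complete spaces are pointed, hence so is this structure. *)
#[short(type="completeMetricType")]
HB.structure Definition CompleteMetric (K : numDomainType) :=
  {M of Metric K M & Complete M}.

Definition separable (E : topologicalType) : Prop :=
  exists2 D : set E, countable D & dense D.

Notation borel E := (g_sigma_algebraType (@open E)).

(* [sup_norm D f] is the supremum of |f| over D, possibly +oo. *)
Definition sup_norm (R : realType) (T : Type) (D : set T) (f : T -> R) : \bar R :=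
  ereal_sup [set `|f x|%:E | x in D].

(* Couplings live on the product sigma-field, which is the Borel sigma-field of
   the product when the space is separable metric. *)
Definition couplings (R : realType) d (T : measurableType d)
    (mu nu : {measure set T -> \bar R}) : set (probability (T * T)%type R) :=
  [set G : probability (T * T)%type R | forall A : set T, measurable A ->
    G (A `*` setT) = mu A /\ G (setT `*` A) = nu A].

Section semigroup.
Context (R : realType) (E : completeMetricType R).

(* A family (P_t) indexed by t >= 0 is encoded as a function on R of which only
   the values at nonnegative times are ever constrained or used. *)
Implicit Type P : R -> R.-pker (borel E) ~> (borel E).

Definition markov_semigroup P : Prop :=
  (forall (x : borel E) (A : set (borel E)), measurable A ->
     P 0 x A = dirac x A) /\
  (forall (s t : R), 0 <= s -> 0 <= t ->
     forall (x : borel E) (A : set (borel E)), measurable A ->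
       P (s + t) x A = (\int[P s x]_y P t y A)%E).

Definition semigroup_act P (t : R) (phi : E -> R) (x : E) : R :=
  \int[P t (x : borel E)]_z phi z.

Definition invariant_measure P (mu : probability (borel E) R) : Prop :=
  forall (t : R) (A : set (borel E)), 0 <= t -> measurable A ->
    (\int[mu]_x P t x A)%E = mu A.

Definition feller P : Prop :=
  forall t : R, 0 <= t -> forall phi : E -> R,
    bounded_fun phi -> continuous phi -> continuous (semigroup_act P t phi).

Definition locally_weak_irreducible P : Prop :=
  exists x0 : E, forall r eps : R, 0 < r -> 0 < eps ->
    exists2 T : R, 0 < T & forall t : R, T <= t ->
      (0 < ereal_inf
        [set ereal_sup
               [set G [set p : borel E * borel E |
                        (mdist (p.1 : E) (p.2 : E) <= eps)%R]
               | G in couplings (P t (xy.1 : borel E)) (P t (xy.2 : borel E))]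
        | xy in ball x0 r `*` ball x0 r])%E.

Definition mdist_lipschitz (K : R) (phi : E -> R) : Prop :=
  forall x y : E, `|phi x - phi y| <= K * mdist x y.

(* Restricting to bounded phi is the convention that the estimate is void when
   the supremum norm of phi is infinite. *)
Definition asf_plus P (F : R -> R) : Prop :=
  feller P /\
  exists (x0 : E) (t_ delta : nat -> R),
    [/\ (forall n, 0 <= t_ n) /\ nondecreasing_seq t_,
        (forall n, 0 < delta n),
        nonincreasing_seq delta /\ delta n @[n --> \oo] --> 0 &
        forall (phi : E -> R) (K : R), 0 < K -> mdist_lipschitz K phi ->
          (sup_norm setT phi < +oo)%E ->
          forall (n : nat), (0 < n)%N -> forall x y : E,
            (`|semigroup_act P (t_ n) phi x - semigroup_act P (t_ n) phi y|%:E
             <= (mdist x y * F (Num.max (mdist x x0) (mdist y x0)))%:E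
                * (sup_norm setT phi + (delta n * K)%:E))%E].

End semigroup.

(* Main.v *)
Require Import Defs.
From HB Require Import structures.
From mathcomp Require Import all_boot all_order all_algebra.
From mathcomp Require Import all_classical all_reals all_analysis.
From mathcomp Require Import measurable_realfun ring lra.

Set Implicit Arguments.
Unset Strict Implicit.
Unset Printing Implicit Defensive.

Import Order.TTheory GRing.Theory Num.Theory.
Import numFieldNormedType.Exports.

Local Open Scope classical_set_scope.
Local Open Scope ring_scope.

(** Why two invariant probability measures agree.

    Write C for a bound of F. Take a K-Lipschitz function f with values in [0, 1]
    and n so large that delta_n K <= 1; ASF+ then says that P_{t_n} f varies by at
    most 2 C d(x, y) between x and y, hence by at most 1/2 below a scale e that
    depends on C alone ([asf_plus_gap]). By local weak irreducibility there is a
    time T at which the laws P_T(x, .) and P_T(y, .), for x and y in a given ball,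
    have a coupling that puts mass at least b > 0 on the pairs at distance at most
    e; integrating P_{t_n} f against that coupling shows that P_T P_{t_n} f
    oscillates by at most 1 - b/2 on the ball ([coupling_gap]). If mu and nu are
    invariant and both charge the ball, then
    mu f - nu f = mu (P_T P_{t_n} f) - nu (P_T P_{t_n} f) <= 1 - c
    with some c > 0 that does not depend on f, not even through K
    ([oscillation_gap], [invariant_measure_gap]).

    This estimate forbids mutual singularity. Lipschitz functions with values in
    [0, 1] are dense in L1 among the indicators of Borel sets
    ([measurable_lipschitz_approximable]), so if mu and nu were carried by S and
    by the complement of S, some such f would have mu f - nu f as close to 1 as
    desired ([invariant_measure_not_singular]).

    Finally, if mu and nu differ, the positive and negative parts of mu - nu are
    nonzero, mutually singular, and again invariant ([invariant_singular_part]);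
    once normalised, they are two invariant probability measures of the kind just
    excluded. *)

(** * Borel measurability in metric spaces *)

Section lipschitz_measurable.
Context {R : realType} {E : completeMetricType R}.

Lemma continuous_borel_measurable (f : E -> R) :
  continuous f -> measurable_fun setT (f : borel E -> R).
Proof.
move=> cf; apply: (measurability _ (RGenOpens.measurableE R)).
move=> _ [_ [a [b ->]] <-]; rewrite setTI.
apply: sub_sigma_algebra.
by apply: open_comp => // x _; exact: cf.
Qed.

Lemma mdist_lipschitz_continuous (K : R) (f : E -> R) :
  0 < K -> mdist_lipschitz K f -> continuous f.
Proof.
move=> K0 fK x; apply/cvgrPdist_le => /= e e0.
near=> y.
apply: (le_trans (fK x y)).
rewrite mulrC -ler_pdivlMr// ltW//.
suff : ball x (e / K) y by rewrite ballEmdist.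
near: y; apply: nbhsx_ballx; exact: divr_gt0.
Unshelve. all: by end_near. Qed.

Lemma mdist_lipschitz_measurable (K : R) (f : E -> R) :
  0 < K -> mdist_lipschitz K f -> measurable_fun setT (f : borel E -> R).
Proof.
by move=> K0 /(mdist_lipschitz_continuous K0)/continuous_borel_measurable.
Qed.

Lemma mdist_lipschitz_dist (z : E) : mdist_lipschitz 1 (mdist^~ z).
Proof.
move=> x y; rewrite mul1r ler_norml.
have := metric_triangle x y z; have := metric_triangle y x z.
rewrite (metric_sym y x); lra.
Qed.

Lemma measurable_mdist (z : E) : measurable_fun setT (mdist^~ z : borel E -> R).
Proof. exact: (mdist_lipschitz_measurable ltr01 (mdist_lipschitz_dist z)). Qed.

Lemma measurable_mball (x : E) (r : R) :
  measurable (ball x r : set (borel E)).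
Proof.
rewrite (_ : ball x r = [set: borel E] `&` (mdist^~ x) @^-1` [set` `]-oo, r[]).
  by apply: measurable_mdist => //; exact: measurable_itv.
rewrite ballEmdist; apply/seteqP.
by split => y /=; rewrite in_itv/= metric_sym => // -[].
Qed.

(** Points z of a countable dense set turn the condition d(x, y) <= e into
    countably many conditions d(y, z) - d(x, z) <= e, each of which belongs to the
    product sigma-field. *)
Lemma measurable_mdist_le (e : R) : separable E ->
  measurable [set p : borel E * borel E | mdist (p.1 : E) (p.2 : E) <= e].
Proof.
move=> [D cD dD].
have -> : [set p : borel E * borel E | mdist (p.1 : E) (p.2 : E) <= e] =
    \bigcap_(z in D) [set p : borel E * borel E |
       mdist (p.2 : E) z - mdist (p.1 : E) z <= e].
  apply/seteqP; split => [[x y] /= xye z _|[x y] /= H].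
    by have /= := metric_triangle y x z; rewrite (metric_sym y x); lra.
  apply/ler_addgt0Pr => d d0.
  have d20 : 0 < d / 2 by exact: divr_gt0.
  have [|z [/= xz Dz]] := dD _ _ (@open_interior _ (ball x (d / 2))).
    by exists x; exact: nbhsx_ballx.
  have {}xz : mdist x z < d / 2.
    by have /= := interior_subset xz; rewrite ballEmdist.
  have /= := H z Dz; have := metric_triangle x z y.
  by rewrite (metric_sym y z); lra.
rewrite -[X in measurable X]setCK; apply: measurableC.
rewrite setC_bigcap bigcup_set_type.
apply: countable_bigcupT_measurable; first by rewrite (eq_countable (card_setT _)).
move=> [z Dz]/=; apply: measurableC.
pose f (p : borel E * borel E) : R := mdist (p.2 : E) z - mdist (p.1 : E) z.
have mf : measurable_fun setT f.
  exact: measurable_funB (measurableT_comp (measurable_mdist z) measurable_snd)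
    (measurableT_comp (measurable_mdist z) measurable_fst).
rewrite (_ : [set _ | _] = setT `&` f @^-1` [set` `]-oo, e]]).
  by apply: mf => //; exact: measurable_itv.
by apply/seteqP; split => [p|p []] /=; rewrite in_itv.
Qed.

End lipschitz_measurable.

(** * Integrals of functions with values in the unit interval *)

Section unit_valued.
Context d (T : measurableType d) (R : realType).
Implicit Types (m : {measure set T -> \bar R}) (f : T -> R).

Lemma probability_setT_lty (m : probability T R) : (m setT < +oo)%E.
Proof. by rewrite probability_setT ltry. Qed.

Lemma integrable_unit_valued m f : (m setT < +oo)%E ->
  measurable_fun setT f -> (forall x, 0 <= f x <= 1) ->
  m.-integrable setT (EFin \o f).
Proof.
move=> mfin mf f01; apply: measurable_bounded_integrable => //.
exists 1; split => // M M1 x _ /=; have /andP[f0 f1] := f01 x.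
by rewrite ger0_norm// (le_trans f1)// ltW.
Qed.

Lemma Rintegral_unit_valued m f : m setT = 1%E ->
  measurable_fun setT f -> (forall x, 0 <= f x <= 1) ->
  0 <= \int[m]_x f x <= 1.
Proof.
move=> m1 mf f01; have mfin : (m setT < +oo)%E by rewrite m1 ltry.
rewrite Rintegral_ge0/=; last by move=> x _; case/andP: (f01 x).
have -> : 1 = \int[m]_(x in setT) 1 :> R by rewrite Rintegral_cst// m1/= mulr1.
apply: le_Rintegral => //.
- exact: integrable_unit_valued.
- by apply: (integrable_unit_valued (f := cst 1)) => // x; rewrite /= ler01 lexx.
- by move=> x _; case/andP: (f01 x).
Qed.

Lemma Rintegral_indic m (A : set T) : measurable A ->
  \int[m]_x \1_A x = fine (m A).
Proof. by move=> mA; rewrite /Rintegral integral_indic// setIT. Qed.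

Lemma Rintegral_affine_indic m (A : set T) (a b : R) : m setT = 1%E ->
  measurable A -> \int[m]_x (a + b * \1_A x) = a + b * fine (m A).
Proof.
move=> m1 mA; have mfin : (m setT < +oo)%E by rewrite m1 ltry.
have iA : m.-integrable setT (EFin \o \1_A).
  by apply: integrable_unit_valued => // x; rewrite indicE ler0n lern1 leq_b1.
rewrite RintegralD//.
- by rewrite Rintegral_cst// m1/= mulr1 RintegralZl// Rintegral_indic.
- apply: measurable_bounded_integrable => //; exact: bounded_cst.
- exact: (integrableZl _ b iA).
Qed.

End unit_valued.

(** The total masses being 1, the two integrals differ by less than 1 as soon as
    both measures charge a set on which g oscillates by less than 1: with q the
    smaller of a and the infimum of g on B, one has
    q 1_B <= g <= 1 - (a - q) 1_B. *)
Lemma oscillation_gap d (T : measurableType d) (R : realType)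
    (mu nu : probability T R) (B : set T) (a : R) (g : T -> R) :
  measurable B -> 0 <= a -> measurable_fun setT g ->
  (forall x, 0 <= g x <= 1) ->
  (forall x y, B x -> B y -> g x - g y <= 1 - a) ->
  \int[mu]_x g x - \int[nu]_x g x <=
    1 - a * Num.min (fine (mu B)) (fine (nu B)).
Proof.
move=> mB a0 mg g01 oscg.
set u := fine (mu B); set v := fine (nu B).
have u0 : 0 <= u by exact: fine_ge0.
have v0 : 0 <= v by exact: fine_ge0.
have [q [q0 qa qlo qhi]] : exists q, [/\ 0 <= q, q <= a,
    (forall x, B x -> q <= g x) & forall x, B x -> g x <= 1 - (a - q)].
  have [->|/set0P[x0 Bx0]] := eqVneq B set0; first by exists 0; split.
  pose S := [set g x | x in B].
  have lbS : lbound S 0 by move=> _ [x _ <-]; case/andP: (g01 x).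
  have hS : has_inf S by split; [exists (g x0), x0|exists 0].
  have infS x : B x -> inf S <= g x.
    by move=> Bx; apply: ge_inf; [exists 0|exists x].
  exists (Num.min a (inf S)); split.
  - by rewrite le_min a0/=; apply: lb_le_inf => //; exists (g x0), x0.
  - by rewrite ge_min lexx.
  - by move=> x Bx; rewrite ge_min infS ?orbT.
  - move=> x Bx; have /andP[_ gx1] := g01 x.
    rewrite minEle; case: ifPn => _; first by rewrite subrr subr0.
    suff : g x - (1 - a) <= inf S by lra.
    apply: lb_le_inf; first by exists (g x0), x0.
    by move=> _ [y By <-]; have := oscg x y Bx By; lra.
have ifin (m : probability T R) (f : T -> R) : measurable_fun setT f ->
    (forall x, 0 <= f x <= 1) -> m.-integrable setT (EFin \o f).
  by apply: integrable_unit_valued; exact: probability_setT_lty.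
have iaff (m : probability T R) (s b : R) :
    m.-integrable setT (EFin \o (fun x => s + b * \1_B x)).
  apply: measurable_bounded_integrable => //.
  - exact: probability_setT_lty.
  - exact: measurable_funD (measurable_cst _)
      (measurable_funM (measurable_cst _) (measurable_indic mB)).
  - exists (`|s| + `|b|); split => // M /ltW sbM x _ /=.
    apply: le_trans sbM; apply: (le_trans (ler_normD _ _)); rewrite lerD2l.
    by rewrite indicE; case: (x \in B); rewrite ?mulr1// mulr0 normr0.
have hi : \int[mu]_x g x <= 1 + - (a - q) * u.
  rewrite -Rintegral_affine_indic//; last exact: probability_setT.
  apply: le_Rintegral => //; [exact: ifin|exact: iaff|].
  move=> x _; rewrite indicE; have [/set_mem Bx|_] := boolP (x \in B).
    by rewrite mulr1; exact: qhi.
  by rewrite mulr0 addr0; case/andP: (g01 x).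
have lo : 0 + q * v <= \int[nu]_x g x.
  rewrite -Rintegral_affine_indic//; last exact: probability_setT.
  apply: le_Rintegral => //; [exact: iaff|exact: ifin|].
  move=> x _; rewrite indicE; have [/set_mem Bx|_] := boolP (x \in B).
    by rewrite mulr1 add0r; exact: qlo.
  by rewrite mulr0 addr0; case/andP: (g01 x).
have mu_ : Num.min u v <= u by rewrite ge_min lexx.
have mv_ : Num.min u v <= v by rewrite ge_min lexx orbT.
have : (a - q) * Num.min u v <= (a - q) * u by rewrite ler_wpM2l// subr_ge0.
have : q * Num.min u v <= q * v by rewrite ler_wpM2l.
nra.
Qed.

(** * Integration against an invariant measure *)

Section invariance.
Context {R : realType} {E : completeMetricType R}.
Variable P : R -> R.-pker (borel E) ~> (borel E).

Lemma invariant_measure_integral (mu : probability (borel E) R) (t : R)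
    (f : borel E -> \bar R) : invariant_measure P mu -> 0 <= t ->
  measurable_fun setT f -> (forall x, 0 <= f x)%E ->
  (\int[mu]_x \int[P t x]_y f y = \int[mu]_x f x)%E.
Proof.
move=> imu t0 mf f0.
(* mu, seen as a kernel out of the one-point space, composed with P t *)
pose l := kprobability (@measurable_cst _ _ unit (pprobability (borel E) R) setT mu).
pose k := @kernel.kernel_snd _ _ _ unit _ _ R (P t).
have := @integral_kcomp _ _ _ unit (borel E) (borel E) R l k tt f f0 mf.
rewrite /l /k /kprobability /kernel.kernel_snd/= => <-.
apply: eq_measure_integral => A mA _.
by have := imu t A t0 mA; rewrite /kcomp.
Qed.

Lemma semigroup_act_unit_valued (t : R) (f : E -> R) :
  measurable_fun setT (f : borel E -> R) -> (forall x, 0 <= f x <= 1) ->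
  forall x, 0 <= semigroup_act P t f x <= 1.
Proof. by move=> mf f01 x; apply: Rintegral_unit_valued => //; exact: prob_kernel. Qed.

Lemma invariant_measure_Rintegral (mu : probability (borel E) R) (t : R)
    (f : E -> R) : invariant_measure P mu -> 0 <= t ->
  measurable_fun setT (f : borel E -> R) -> (forall x, 0 <= f x <= 1) ->
  \int[mu]_x semigroup_act P t f x = \int[mu]_x f x.
Proof.
move=> imu t0 mf f01.
have mEf : measurable_fun setT (EFin \o f : borel E -> \bar R).
  exact/measurable_EFinP.
have Ef0 x : (0 <= (EFin \o f) x)%E by rewrite lee_fin; case/andP: (f01 x).
congr fine; rewrite -[RHS](invariant_measure_integral imu t0 mEf Ef0).
apply: eq_integral => x _; rewrite fineK//.
apply: integrable_fin_num => //; apply: integrable_unit_valued => //.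
by rewrite prob_kernel ltry.
Qed.

End invariance.

(** * Couplings concentrated near the diagonal *)

Lemma Rintegral_image d1 d2 (X : measurableType d1) (Y : measurableType d2)
    (R : realType) (phi : X -> Y) (mphi : measurable_fun setT phi)
    (m : {measure set X -> \bar R}) (n : {measure set Y -> \bar R}) (f : Y -> R) :
  (forall A, measurable A -> m (phi @^-1` A) = n A) ->
  measurable_fun setT f -> (forall y, 0 <= f y) ->
  \int[n]_y f y = \int[m]_x (f \o phi) x.
Proof.
move=> mn mf f0; congr fine.
have mEf : measurable_fun setT (EFin \o f) by exact/measurable_EFinP.
rewrite -[RHS](@ge0_integral_pushforward _ _ _ _ R phi mphi m setT (EFin \o f)) //.
- by apply: eq_measure_integral => A mA _; rewrite -mn.
- by move=> y _; rewrite lee_fin.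
Qed.

(** The difference of the two integrals is the integral of f x - f y against the
    coupling; the integrand is at most 1/2 on the near-diagonal set, and the
    trivial bound 1 serves elsewhere. *)
Lemma coupling_gap (R : realType) (E : completeMetricType R)
    (m1 m2 : {measure set (borel E) -> \bar R})
    (G : probability (borel E * borel E)%type R) (e : R) (f : E -> R) :
  separable E -> couplings m1 m2 G ->
  measurable_fun setT (f : borel E -> R) -> (forall x, 0 <= f x <= 1) ->
  (forall x y, mdist x y <= e -> f x - f y <= 2^-1) ->
  \int[m1]_x f x - \int[m2]_x f x <=
    1 - 2^-1 * fine (G [set p : borel E * borel E | mdist (p.1 : E) (p.2 : E) <= e]).
Proof.
move=> sE cG mf f01 fe.
pose S : set (borel E * borel E) := [set p | mdist (p.1 : E) (p.2 : E) <= e].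
rewrite -/S.
have mS : measurable S by exact: measurable_mdist_le.
have mf1 : measurable_fun setT (f \o fst : borel E * borel E -> R).
  exact: measurableT_comp mf measurable_fst.
have mf2 : measurable_fun setT (f \o snd : borel E * borel E -> R).
  exact: measurableT_comp mf measurable_snd.
have Gfin := probability_setT_lty G.
have i1 : G.-integrable setT (EFin \o (f \o fst)).
  by apply: integrable_unit_valued => // x; exact: f01.
have i2 : G.-integrable setT (EFin \o (f \o snd)).
  by apply: integrable_unit_valued => // x; exact: f01.
have -> : \int[m1]_x f x = \int[G]_p (f \o fst) p.
  apply: (Rintegral_image measurable_fst) => // [A mA|x]; last by case/andP: (f01 x).
  have [<- _] := cG A mA; congr (G _).
  by apply/seteqP; split => [p|p []].
have -> : \int[m2]_x f x = \int[G]_p (f \o snd) p.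
  apply: (Rintegral_image measurable_snd) => // [A mA|x]; last by case/andP: (f01 x).
  have [_ <-] := cG A mA; congr (G _).
  by apply/seteqP; split => [p|p []].
rewrite -RintegralB// -mulNr -Rintegral_affine_indic//; last exact: probability_setT.
apply: le_Rintegral => //.
- exact: (integrableB measurableT i1 i2).
- apply: measurable_bounded_integrable => //.
  + exact: measurable_funD (measurable_cst _)
      (measurable_funM (measurable_cst _) (measurable_indic mS)).
  + exists 2; split => // M M2 p _ /=; rewrite indicE.
    by apply: (le_trans _ (ltW M2)); rewrite ler_norml; case: (p \in S) => /=;
      rewrite ?mulr1 ?mulr0; lra.
- move=> [x y] _ /=; rewrite indicE; have [/set_mem /= xye|_] := boolP (_ \in S).
    by have := fe x y xye; lra.
  by rewrite mulr0; have /andP[? ?] := f01 x; have /andP[? ?] := f01 y; lra.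
Qed.

(** * A uniform gap between invariant measures *)

Section contraction.
Context {R : realType} {E : completeMetricType R}.
Variable P : R -> R.-pker (borel E) ~> (borel E).

(** Choosing n with delta_n K <= 1 makes the ASF+ estimate at time t_n at most
    2 C d(x, y), with C a bound of F; the scale e below which this is at most 1/2
    therefore depends neither on K nor on the position of x and y. The constant
    is 1/(4 (C + 1)), as C may vanish. *)
Lemma asf_plus_gap (F : R -> R) (hF0 : forall r : R, 0 <= r -> 0 <= F r)
    (hFbnd : (sup_norm [set` `[0%R, +oo[] F < +oo)%E) (hasf : asf_plus P F) :
  exists2 e : R, 0 < e & forall K : R, 0 < K -> exists2 t : R, 0 <= t &
    forall f : E -> R, mdist_lipschitz K f -> (forall x, 0 <= f x <= 1) ->
    forall x y, mdist x y <= e ->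
      semigroup_act P t f x - semigroup_act P t f y <= 2^-1.
Proof.
have [C C0 FC] : exists2 C : R, 0 <= C & forall r, 0 <= r -> F r <= C.
  have Fs r : 0 <= r -> (`|F r|%:E <= sup_norm [set` `[0%R, +oo[] F)%E.
    by move=> r0; apply: ereal_sup_ubound; exists r => //=; rewrite in_itv/= r0.
  have sfin : sup_norm [set` `[0%R, +oo[] F \is a fin_num.
    rewrite ge0_fin_numE//; apply: le_trans (Fs 0 (lexx _)); exact: lee_tofin.
  exists (fine (sup_norm [set` `[0%R, +oo[] F)).
    rewrite -lee_fin fineK//; apply: le_trans (Fs 0 (lexx _)); exact: lee_tofin.
  move=> r r0; rewrite -lee_fin fineK//; apply: le_trans (Fs r r0).
  by rewrite lee_fin ler_norm.
case: hasf => _ [x0 [t_ [delta [[t0 _] delta0 [_ deltacvg] H]]]].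
exists (4 * (C + 1))^-1; first by rewrite invr_gt0; lra.
move=> K K0.
have [n n0 dn] : exists2 n, (0 < n)%N & delta n * K <= 1.
  have /cvgrPdist_le/(_ K^-1) := deltacvg.
  rewrite invr_gt0 => /(_ K0) [N _ HN].
  exists N.+1 => //; have /= := HN N.+1 (leqnSn N).
  rewrite sub0r normrN => /(le_trans (ler_norm _)).
  by rewrite -[K^-1]div1r ler_pdivlMr.
exists (t_ n) => // f fK f01 x y xy.
have fsup : (sup_norm setT f <= 1)%E.
  apply: ge_ereal_sup => _ [z _ <-]; rewrite lee_fin.
  by have /andP[? ?] := f01 z; rewrite ger0_norm.
have := H f K K0 fK (le_lt_trans fsup (ltry 1)) n n0 x y.
set D := mdist x y; set M := Num.max _ _ => Hn.
have D0 : 0 <= D by exact: mdist_ge0.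
have M0 : 0 <= M by rewrite le_max mdist_ge0.
apply: (le_trans (ler_norm _)); rewrite -lee_fin.
apply: (le_trans Hn).
apply: (@le_trans _ _ ((D * F M) * 2)%:E).
  rewrite [leRHS]EFinM; apply: lee_wpmul2l.
    by rewrite lee_fin mulr_ge0// hF0.
  rewrite (_ : 2%:E = 1 + 1)%E; last by rewrite -EFinD.
  by apply: leeD => //; rewrite lee_fin.
rewrite lee_fin.
have C1 : 0 < 4 * (C + 1) by lra.
have : D * (4 * (C + 1)) <= 1 by rewrite -ler_pdivlMr// div1r.
have : D * F M <= D * C by rewrite ler_wpM2l// FC.
by nra.
Qed.

Lemma probability_ball_gt0 (mu : probability (borel E) R) (x : E) :
  exists2 r : R, 0 < r & forall s, r <= s -> (0 < mu (ball x s : set (borel E)))%E.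
Proof.
pose B (n : nat) : set (borel E) := ball x n.+1%:R.
have mB n : measurable (B n) by exact: measurable_mball.
have [n mun] : exists n, mu (B n) != 0%E.
  apply: contrapT => /forallNP mu0.
  have BT : \bigcup_n B n = setT.
    apply/seteqP; split => // y _; exists (Num.truncn (mdist x y)) => //.
    by rewrite /B ballEmdist/=; exact: truncnS_gt.
  have := measure_sigma_subadditive mu mB (bigcupT_measurable _ mB) (@subset_refl _ _).
  rewrite eseries0; last by move=> n _ _; exact/eqP/negPn/negP/mu0.
  rewrite BT => muT0; have : (1 <= 0 :> \bar R)%E.
    by apply: le_trans muT0; rewrite le_eqVlt; apply/orP; left;
      apply/eqP/esym; exact: probability_setT.
  by rewrite lee_fin ler10.
exists n.+1%:R => // s ns; apply: (@lt_le_trans _ _ (mu (B n))).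
  by rewrite lt0e mun measure_ge0.
apply: le_measure; rewrite ?inE; try exact: measurable_mball.
by apply: le_ball.
Qed.

(** Two invariant measures stay a fixed amount away from being mutually singular,
    as far as Lipschitz functions can tell. The point is that c does not depend
    on the Lipschitz constant: P_T couples any two points of a large ball within
    distance e with a probability bounded below, and after a further time t,
    which is where K enters, the values at two points within e differ by at
    most 1/2. *)
Lemma invariant_measure_gap (F : R -> R) (sE : separable E)
    (hF0 : forall r : R, 0 <= r -> 0 <= F r)
    (hFbnd : (sup_norm [set` `[0%R, +oo[] F < +oo)%E)
    (hirr : locally_weak_irreducible P) (hasf : asf_plus P F)
    (mu nu : probability (borel E) R) :
  invariant_measure P mu -> invariant_measure P nu ->
  exists2 c : R, 0 < c & forall (K : R) (f : E -> R), 0 < K ->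
    mdist_lipschitz K f -> (forall x, 0 <= f x <= 1) ->
    \int[mu]_x f x - \int[nu]_x f x <= 1 - c.
Proof.
move=> imu inu.
have [e e0 He] := asf_plus_gap hF0 hFbnd hasf.
have [x0 irr] := hirr.
have [r1 r10 mur] := probability_ball_gt0 mu x0.
have [r2 r20 nur] := probability_ball_gt0 nu x0.
pose r := Num.max r1 r2.
have r0 : 0 < r by rewrite lt_max r10.
pose B : set (borel E) := ball x0 r.
have muB : 0 < fine (mu B).
  rewrite fine_gt0// mur ?le_max ?lexx//= ltey_eq fin_num_measure//.
  exact: measurable_mball.
have nuB : 0 < fine (nu B).
  rewrite fine_gt0// nur ?le_max ?lexx ?orbT//= ltey_eq fin_num_measure//.
  exact: measurable_mball.
have [T T0 /(_ T (lexx T)) infgt0] := irr r e r0 e0.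
have [b b0 binf] : exists2 b : R, 0 < b & (b%:E < ereal_inf
        [set ereal_sup
               [set G [set p : borel E * borel E |
                        (mdist (p.1 : E) (p.2 : E) <= e)%R]
               | G in couplings (P T (xy.1 : borel E)) (P T (xy.2 : borel E))]
        | xy in ball x0 r `*` ball x0 r])%E.
  case: ereal_inf infgt0 => [s| |]//.
  - by rewrite lte_fin => s0; exists (s / 2); rewrite ?lte_fin; lra.
  - by exists 1 => //; rewrite ltry.
exists (b / 2 * Num.min (fine (mu B)) (fine (nu B))).
  by rewrite !mulr_gt0// lt_min muB nuB.
move=> K f K0 fK f01.
have [t t0 Ht] := He K K0.
have cf : continuous f by exact: mdist_lipschitz_continuous K0 fK.
have mf := continuous_borel_measurable cf.
have bf : bounded_fun f.
  exists 1; split => // M M1 x _ /=; have /andP[? ?] := f01 x.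
  by rewrite ger0_norm// (le_trans _ (ltW M1)).
have mPf : measurable_fun setT (semigroup_act P t f : borel E -> R).
  apply: continuous_borel_measurable; case: hasf => /(_ t t0 f bf cf) + _; exact.
have Pf01 := semigroup_act_unit_valued P t mf f01.
have bPf : bounded_fun (semigroup_act P t f).
  exists 1; split => // M M1 x _ /=; have /andP[? ?] := Pf01 x.
  by rewrite ger0_norm// (le_trans _ (ltW M1)).
have cPf : continuous (semigroup_act P t f).
  by case: hasf => /(_ t t0 f bf cf) + _; exact.
have mPPf : measurable_fun setT (semigroup_act P T (semigroup_act P t f) : borel E -> R).
  apply: continuous_borel_measurable.
  by case: hasf => /(_ T (ltW T0) _ bPf cPf) + _; exact.
have PPf01 := semigroup_act_unit_valued P T mPf Pf01.
rewrite -(invariant_measure_Rintegral imu t0 mf f01).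
rewrite -(invariant_measure_Rintegral inu t0 mf f01).
rewrite -(invariant_measure_Rintegral imu (ltW T0) mPf Pf01).
rewrite -(invariant_measure_Rintegral inu (ltW T0) mPf Pf01).
apply: oscillation_gap => //; first exact: measurable_mball.
  by rewrite divr_ge0// ltW.
move=> x y Bx By.
have : (b%:E < ereal_sup
               [set G [set p : borel E * borel E |
                        (mdist (p.1 : E) (p.2 : E) <= e)%R]
               | G in couplings (P T (x : borel E)) (P T (y : borel E))])%E.
  by apply: (lt_le_trans binf); apply: ereal_inf_lbound; exists (x, y).
move=> /ereal_sup_gt[_ [G cG <-] bG].
apply: (le_trans (coupling_gap sE cG mPf Pf01 (Ht f fK f01))).
rewrite lerD2l lerN2 mulrC ler_wpM2l// -lee_fin fineK ?ltW//.
by rewrite fin_num_measure//; exact: measurable_mdist_le.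
Qed.

End contraction.

(** * Approximation of Borel sets by Lipschitz functions *)

Section lipschitz_envelope.
Context {R : realType} {E : completeMetricType R}.
Implicit Types (u : E -> R) (k : R).

(** The largest k-Lipschitz function below u (inf-convolution of u with k d). *)
Definition lipschitz_envelope u k (x : E) : R :=
  inf [set u z + k * mdist x z | z in setT].

Variables (u : E -> R) (k : R).
Hypotheses (u0 : forall x, 0 <= u x) (k0 : 0 <= k).

Lemma lipschitz_envelope_le x z :
  lipschitz_envelope u k x <= u z + k * mdist x z.
Proof.
apply: ge_inf; last by exists z.
by exists 0 => _ [w _ <-]; rewrite addr_ge0// mulr_ge0// mdist_ge0.
Qed.

Lemma le_lipschitz_envelope x (c : R) :
  (forall z, c <= u z + k * mdist x z) -> c <= lipschitz_envelope u k x.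
Proof.
move=> cu; apply: lb_le_inf; first by exists (u x + k * mdist x x), x.
by move=> _ [z _ <-].
Qed.

Lemma lipschitz_envelope_lipschitz : mdist_lipschitz k (lipschitz_envelope u k).
Proof.
have H x y : lipschitz_envelope u k x - k * mdist x y <= lipschitz_envelope u k y.
  apply: le_lipschitz_envelope => z; have := lipschitz_envelope_le x z.
  have : k * mdist x z <= k * mdist x y + k * mdist y z.
    by rewrite -mulrDr ler_wpM2l// metric_triangle.
  lra.
move=> x y; rewrite ler_norml; have := H x y; have := H y x.
rewrite (metric_sym y x); lra.
Qed.

Lemma lipschitz_envelope_ge0 x : 0 <= lipschitz_envelope u k x.
Proof.
by apply: le_lipschitz_envelope => z; rewrite addr_ge0// mulr_ge0// mdist_ge0.
Qed.

Lemma lipschitz_envelope_le_id x : lipschitz_envelope u k x <= u x.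
Proof. by have := lipschitz_envelope_le x x; rewrite mdistxx mulr0 addr0. Qed.

End lipschitz_envelope.

(** On an open set the envelopes of the indicator are eventually equal to 1: the
    competitors outside the set sit at a positive distance. *)
Lemma lipschitz_envelope_indic_cvg (R : realType) (E : completeMetricType R)
    (U : set E) (x : E) : open U ->
  lipschitz_envelope (\1_U) n%:R x @[n --> \oo] --> (\1_U x : R).
Proof.
move=> oU.
have u0 y : 0 <= (\1_U y : R) by rewrite indicE ler0n.
have [Ux|nUx] := boolP (x \in U); last first.
  have x0 : \1_U x = 0 :> R by rewrite indicE (negbTE nUx).
  rewrite (_ : (fun n : nat => _) = cst (\1_U x)); first exact: cvg_cst.
  apply/funext => n /=; apply/eqP; rewrite eq_le lipschitz_envelope_le_id//.
  by rewrite x0 lipschitz_envelope_ge0.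
have x1 : \1_U x = 1 :> R by rewrite indicE Ux.
have /nbhs_ballP[r /= r0 rU] : nbhs x U.
  by apply: open_nbhs_nbhs; split => //; exact: set_mem.
apply: cvg_near_cst; near=> n.
apply/eqP; rewrite eq_le lipschitz_envelope_le_id//= x1.
apply: le_lipschitz_envelope => // z.
have nr : 1 <= n%:R * r.
  rewrite -ler_pdivrMr// ltW//; near: n; exact: nbhs_infty_gtr.
have [xz|xz] := ltP (mdist x z) r.
  have /mem_set Uz : U z by apply: rU; rewrite ballEmdist.
  by rewrite indicE Uz lerDl mulr_ge0// mdist_ge0.
apply: (le_trans nr); apply: (@le_trans _ _ (n%:R * mdist x z)).
  by rewrite ler_wpM2l.
by rewrite lerDr.
Unshelve. all: by end_near. Qed.

Section lipschitz_dense.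
Context {R : realType} {E : completeMetricType R}.
Variable m : {measure set (borel E) -> \bar R}.
Hypothesis mfin : (m setT < +oo)%E.

Definition lipschitz_approximable (A : set (borel E)) : Prop :=
  measurable A /\ forall e : R, 0 < e -> exists (K : R) (f : E -> R),
    [/\ 0 < K, mdist_lipschitz K f, (forall x, 0 <= f x <= 1) &
        \int[m]_x `|f x - \1_A x| <= e].

Let integrable_dist (g h : borel E -> R) :
  measurable_fun setT g -> measurable_fun setT h ->
  (forall x, 0 <= g x <= 1) -> (forall x, 0 <= h x <= 1) ->
  m.-integrable setT (EFin \o (fun x => `|g x - h x|)).
Proof.
move=> mg mh g01 h01; apply: integrable_unit_valued => //.
  by apply: (measurableT_comp (@normr_measurable R setT)); exact: measurable_funB.
move=> x; rewrite normr_ge0/= ler_norml.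
by have /andP[? ?] := g01 x; have /andP[? ?] := h01 x; lra.
Qed.

Let indic01 (A : set (borel E)) x : 0 <= (\1_A x : R) <= 1.
Proof. by rewrite indicE ler0n lern1 leq_b1. Qed.

Let unit_valued_L1_cvg (f : nat -> borel E -> R) (h : borel E -> R) (e : R) :
  (forall n, measurable_fun setT (f n)) -> measurable_fun setT h ->
  (forall n x, 0 <= f n x <= 1) -> (forall x, 0 <= h x <= 1) ->
  (forall x, f n x @[n --> \oo] --> h x) -> 0 < e ->
  exists n, \int[m]_x `|f n x - h x| <= e.
Proof.
move=> mf mh f01 h01 fh e0.
have [] := @dominated_convergence _ (borel E) R m setT measurableT
  (fun n => EFin \o f n) (EFin \o h) (EFin \o cst 1).
- by move=> n; exact/measurable_EFinP.
- exact/measurable_EFinP.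
- by apply/aeW => x _; apply/fine_cvgP; split; [exact: nearW|exact: fh].
- by apply: integrable_unit_valued => // x; rewrite /= ler01 lexx.
- apply/aeW => x n _; rewrite /= lee_fin.
  by have /andP[? ?] := f01 n x; rewrite ger0_norm.
move=> _ /fine_cvgP[_ /cvgrPdist_le /(_ e e0)] [n _ /(_ n (leqnn n))] /= + _.
by rewrite sub0r normrN => /(le_trans (ler_norm _)) ?; exists n.
Qed.

Lemma lipschitz_approximable_open (U : set E) :
  open U -> lipschitz_approximable (U : set (borel E)).
Proof.
move=> oU; have mU : measurable (U : set (borel E)) by exact: sub_sigma_algebra.
split => // e e0.
have u0 y : 0 <= (\1_U y : R) by rewrite indicE ler0n.
pose f (n : nat) := lipschitz_envelope (\1_U : E -> R) n.+1%:R.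
have fK n : mdist_lipschitz n.+1%:R (f n) by exact: lipschitz_envelope_lipschitz.
have f01 n x : 0 <= f n x <= 1.
  rewrite lipschitz_envelope_ge0//=; have /andP[_] := indic01 U x.
  by apply: le_trans; exact: lipschitz_envelope_le_id.
have mf n : measurable_fun setT (f n : borel E -> R).
  exact: mdist_lipschitz_measurable (fK n).
have [n fn] : exists n, \int[m]_x `|f n x - \1_U x| <= e.
  apply: (unit_valued_L1_cvg mf (measurable_indic mU) f01 (indic01 _) _ e0) => x.
  have := lipschitz_envelope_indic_cvg (x := x) oU.
  by rewrite -(cvg_shiftS (fun n => lipschitz_envelope (\1_U) n%:R x)).
by exists n.+1%:R, (f n); split.
Qed.

Lemma lipschitz_approximableC (A : set (borel E)) :
  lipschitz_approximable A -> lipschitz_approximable (~` A).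
Proof.
move=> [mA HA]; split => [|e /HA [K [f [K0 fK f01 fA]]]]; first exact: measurableC.
exists K, (fun x => 1 - f x); split => //.
- move=> x y; rewrite (_ : 1 - f x - (1 - f y) = - (f x - f y)); last by ring.
  by rewrite normrN.
- by move=> x; have /andP[? ?] := f01 x; lra.
- rewrite (_ : (fun x => `|1 - f x - \1_(~` A) x|) = (fun x => `|f x - \1_A x|))//.
  apply/funext => x; rewrite -normrN !indicE in_setC; congr (`|_|).
  by case: (x \in A) => /=; ring.
Qed.

(** The maximum of two functions is 1-Lipschitz in each of them and sends two
    indicators to the indicator of the union. *)
Lemma lipschitz_approximableU (A B : set (borel E)) :
  lipschitz_approximable A -> lipschitz_approximable B ->
  lipschitz_approximable (A `|` B).
Proof.
move=> [mA HA] [mB HB]; split => [|e e0]; first exact: measurableU.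
have e20 : 0 < e / 2 by lra.
have [K [f [K0 fK f01 fA]]] := HA _ e20.
have [L [g [L0 gL g01 gB]]] := HB _ e20.
have mf := mdist_lipschitz_measurable K0 fK.
have mg := mdist_lipschitz_measurable L0 gL.
have max01 x : 0 <= Num.max (f x) (g x) <= 1.
  rewrite le_max ge_max; have /andP[-> ->] := f01 x.
  by have /andP[_ ->] := g01 x.
have max_dist (a b c d : R) : `|Num.max a b - Num.max c d| <= `|a - c| + `|b - d|.
  rewrite !maxEle; do 2 case: ifPn; rewrite ler_norml;
    by case: (ler0P (a - c)); case: (ler0P (b - d)); lra.
have mm : measurable_fun setT (fun x : borel E => Num.max (f x) (g x)).
  exact: measurable_maxr.
exists (K + L), (fun x => Num.max (f x) (g x)); split => //.
- exact: addr_gt0.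
- move=> x y; apply: (le_trans (max_dist _ _ _ _)).
  by rewrite mulrDl lerD.
- have iA := integrable_dist mf (measurable_indic mA) f01 (indic01 A).
  have iB := integrable_dist mg (measurable_indic mB) g01 (indic01 B).
  rewrite (splitr e); apply: le_trans (lerD fA gB).
  rewrite -RintegralD//; apply: le_Rintegral => //.
  + exact: integrable_dist mm (measurable_indic (measurableU _ _ mA mB)) max01
      (indic01 _).
  + exact: (integrableD measurableT iA iB).
  + move=> x _.
    rewrite (_ : \1_(A `|` B) x = Num.max (\1_A x) (\1_B x)).
      exact: max_dist.
    by rewrite !indicE in_setU; case: (x \in A); case: (x \in B);
      rewrite /= maxEle ?lexx ?ler01 ?ler10.
Qed.

(** The indicators of the finite unions converge to that of the countable union
    pointwise, hence in L1 by dominated convergence, the measure being finite. *)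
Lemma lipschitz_approximable_bigcup (A : nat -> set (borel E)) :
  (forall n, lipschitz_approximable (A n)) ->
  lipschitz_approximable (\bigcup_n A n).
Proof.
move=> HA; have mA n : measurable (A n) by case: (HA n).
have mU : measurable (\bigcup_n A n) by exact: bigcupT_measurable.
split => // e e0.
pose B n := \big[setU/set0]_(i < n) A i.
have HB n : lipschitz_approximable (B n).
  elim: n => [|n IH]; rewrite /B ?big_ord0 ?big_ord_recr/=.
    by apply: lipschitz_approximable_open; exact: open0.
  exact: lipschitz_approximableU.
have mB n : measurable (B n) by case: (HB n).
have e20 : 0 < e / 2 by lra.
have [n Bn] : exists n, \int[m]_x `|\1_(B n) x - \1_(\bigcup_n A n) x| <= e / 2.
  apply: (unit_valued_L1_cvg (fun k => measurable_indic (mB k))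
    (measurable_indic mU) (fun k => indic01 _) (indic01 _) _ e20) => x.
  have [[i _ Aix]|nAx] := pselect ((\bigcup_n A n) x).
    apply: cvg_near_cst; exists i.+1 => // k /= ik.
    rewrite !indicE !mem_set//; first by exists i.
    by rewrite /B -bigcup_mkord; exists i.
  apply: cvg_near_cst; exists 0 => // k _ /=.
  rewrite !indicE !memNset//; rewrite /B -bigcup_mkord => -[i _ Aix].
  by apply: nAx; exists i.
have [K [f [K0 fK f01 fB]]] := (HB n).2 _ e20.
have mf := mdist_lipschitz_measurable K0 fK.
exists K, f; split => //.
have i1 := integrable_dist mf (measurable_indic (mB n)) f01 (indic01 _).
have i2 := integrable_dist (measurable_indic (mB n)) (measurable_indic mU)
  (indic01 _) (indic01 _).
rewrite (splitr e); apply: le_trans (lerD fB Bn).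
rewrite -RintegralD//; apply: le_Rintegral => //.
- exact: integrable_dist mf (measurable_indic mU) f01 (indic01 _).
- exact: (integrableD measurableT i1 i2).
- by move=> x _; exact: ler_distD.
Qed.

(** The approximable sets form a sigma-algebra that contains the open sets. *)
Lemma measurable_lipschitz_approximable (A : set (borel E)) :
  measurable A -> lipschitz_approximable A.
Proof.
move=> mA; have : <<s @open E >> `<=` lipschitz_approximable.
  apply: smallest_sub; last by move=> U; exact: lipschitz_approximable_open.
  split.
  - by apply: lipschitz_approximable_open; exact: open0.
  - by move=> B; rewrite setTD; exact: lipschitz_approximableC.
  - by move=> F; exact: lipschitz_approximable_bigcup.
exact.
Qed.

End lipschitz_dense.

(** * Invariant measures are not mutually singular *)

(** With m = mu + nu, the m-integral of |f - 1_S| controls both 1 - mu f and nu f. *)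
Lemma singular_integral_gap d (T : measurableType d) (R : realType)
    (mu nu : probability T R) (S : set T) (f : T -> R) :
  measurable S -> mu (~` S) = 0%E -> nu S = 0%E ->
  measurable_fun setT f -> (forall x, 0 <= f x <= 1) ->
  1 - \int[measure_add mu nu]_x `|f x - \1_S x| <=
    \int[mu]_x f x - \int[nu]_x f x.
Proof.
move=> mS muS nuS mf f01.
pose h (x : T) : R := `|f x - \1_S x|.
have mh : measurable_fun setT h.
  apply: (measurableT_comp (@normr_measurable R setT)).
  exact: measurable_funB mf (measurable_indic mS).
have h01 x : 0 <= h x <= 1.
  rewrite normr_ge0/= ler_norml indicE.
  by have /andP[? ?] := f01 x; case: (x \in S) => /=; lra.
have ip (n : probability T R) (g : T -> R) : measurable_fun setT g ->
    (forall x, 0 <= g x <= 1) -> n.-integrable setT (EFin \o g).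
  by apply: integrable_unit_valued; exact: probability_setT_lty.
have iS (n : probability T R) : n.-integrable setT (EFin \o (\1_S : T -> R)).
  by apply: ip => // x; rewrite indicE ler0n lern1 leq_b1.
have ih n := ip n h mh h01.
have i_f n := ip n f mf f01.
have hfin (n : probability T R) : (\int[n]_x (h x)%:E)%E \is a fin_num.
  by apply: integrable_fin_num => //; exact: ih.
have -> : \int[measure_add mu nu]_x h x = \int[mu]_x h x + \int[nu]_x h x.
  rewrite /Rintegral -fineD ?hfin//; congr fine; apply: ge0_integral_measure_add => //.
  - by move=> x _; rewrite lee_fin; case/andP: (h01 x).
  - exact/measurable_EFinP.
have lo : \int[mu]_x (\1_S x - h x) <= \int[mu]_x f x.
  apply: le_Rintegral => //; [exact: (integrableB measurableT (iS mu) (ih mu))|exact: i_f|].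
  by move=> x _; rewrite lerBlDr -lerBlDl /h distrC ler_norm.
have hi : \int[nu]_x f x <= \int[nu]_x (\1_S x + h x).
  apply: le_Rintegral => //; [exact: i_f|exact: (integrableD measurableT (iS nu) (ih nu))|].
  by move=> x _; rewrite -lerBlDl ler_norm.
have muS1 : fine (mu S) = 1.
  have : (mu S = 1 - mu (~` S))%E.
    by rewrite -{1}[S]setCK; exact: probability_setC (measurableC mS).
  by rewrite muS sube0 => ->.
have nuS0 : fine (nu S) = 0 by rewrite nuS.
move: lo; rewrite RintegralB//; [|exact: iS|exact: ih]; rewrite Rintegral_indic// muS1.
move: hi; rewrite RintegralD//; [|exact: iS|exact: ih]; rewrite Rintegral_indic// nuS0.
lra.
Qed.

(** A Lipschitz function L1-close to the indicator of S for both measures has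
    integral close to 1 for mu and to 0 for nu, contradicting the gap. *)
Lemma invariant_measure_not_singular (R : realType) (E : completeMetricType R)
    (P : R -> R.-pker (borel E) ~> (borel E)) (F : R -> R) (sE : separable E)
    (hF0 : forall r : R, 0 <= r -> 0 <= F r)
    (hFbnd : (sup_norm [set` `[0%R, +oo[] F < +oo)%E)
    (hirr : locally_weak_irreducible P) (hasf : asf_plus P F)
    (mu nu : probability (borel E) R) (S : set (borel E)) :
  invariant_measure P mu -> invariant_measure P nu ->
  measurable S -> mu (~` S) = 0%E -> nu S = 0%E -> False.
Proof.
move=> imu inu mS muS nuS.
have [c c0 gap] := invariant_measure_gap sE hF0 hFbnd hirr hasf imu inu.
pose m : {measure set (borel E) -> \bar R} := measure_add mu nu.
have mfin : (m setT < +oo)%E.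
  rewrite (_ : m setT = mu setT + nu setT)%E; last exact: measure_addE.
  by apply: lte_add_pinfty; exact: probability_setT_lty.
have c20 : 0 < c / 2 by lra.
have [_ /(_ _ c20) [K [f [K0 fK f01 fS]]]] := measurable_lipschitz_approximable mfin mS.
have mf := mdist_lipschitz_measurable K0 fK.
have := le_trans (singular_integral_gap mS muS nuS mf f01) (gap K f K0 fK f01).
rewrite lerD2l lerN2 => /le_trans /(_ fS).
by rewrite leNgt ltr_pdivrMr// ltr_pMr// ltr1n.
Qed.

(** * Uniqueness through the Jordan decomposition *)

(** On the subsets C of S one has p C = mu C - nu C, and invariance of mu and nu
    turns this into p C = (p P_t) C - (q P_t) C <= (p P_t) C. As p is carried by
    S, it follows that p B <= (p P_t) B for all B; applying this to B and to its
    complement, and since p and p P_t have the same total mass, equality holds. *)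
Lemma invariant_singular_part (R : realType) (E : completeMetricType R)
    (P : R -> R.-pker (borel E) ~> (borel E)) (mu nu : probability (borel E) R)
    (p q : {measure set (borel E) -> \bar R}) (S : set (borel E)) :
  invariant_measure P mu -> invariant_measure P nu -> measurable S ->
  (p setT < +oo)%E -> p (~` S) = 0%E -> q S = 0%E ->
  (forall A, measurable A -> mu A + q A = nu A + p A)%E ->
  forall t A, 0 <= t -> measurable A -> (\int[p]_x P t x A)%E = p A.
Proof.
move=> imu inu mS pfin pS qS eqm t A t0 mA.
have mP (B : set (borel E)) : measurable B -> measurable_fun setT (P t ^~ B).
  exact: measurable_kernel.
have sub (B : set (borel E)) : measurable B -> (p B <= \int[p]_x P t x B)%E.
  move=> mB; have mBS : measurable (B `&` S) by exact: measurableI.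
  have pBS : p B = p (B `&` S).
    have -> : p B = (p (B `\` S) + p (B `&` S))%E by exact: measureDI.
    suff -> : p (B `\` S) = 0%E by rewrite add0e.
    apply/eqP; rewrite eq_le measure_ge0 andbT -pS; apply: le_measure;
      rewrite ?inE//; [exact: measurableD|exact: measurableC].
  have qBS : q (B `&` S) = 0%E.
    apply/eqP; rewrite eq_le measure_ge0 andbT -qS; apply: le_measure; rewrite ?inE//.
  have key : (p (B `&` S) + \int[q]_x P t x (B `&` S) = \int[p]_x P t x (B `&` S))%E.
    have intm : (\int[mu]_x P t x (B `&` S) + \int[q]_x P t x (B `&` S) =
                \int[nu]_x P t x (B `&` S) + \int[p]_x P t x (B `&` S))%E.
      rewrite -!ge0_integral_measure_add//; try exact: mP.
      apply: eq_measure_integral => C mC _.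
      by have := eqm C mC; rewrite -!measure_addE.
    move: intm; rewrite imu// inu//.
    have := eqm _ mBS; rewrite qBS adde0 => ->; rewrite -addeA.
    by move/(congr1 (fun y => y - nu (B `&` S)))%E;
      rewrite ![(nu _ + _)%E]addeC !addeK//; exact: fin_num_measure.
  rewrite pBS; apply: (@le_trans _ _ (\int[p]_x P t x (B `&` S))%E).
    by rewrite -key leeDl// integral_ge0.
  apply: ge0_le_integral => //; try exact: mP.
  by move=> x _; apply: le_measure; rewrite ?inE.
have tot : (\int[p]_x P t x A + \int[p]_x P t x (~` A) = p A + p (~` A))%E.
  have mAc := measurableC mA.
  rewrite -ge0_integralD//; [|exact: mP..].
  rewrite -measureU ?setICr// setUv -[RHS]mul1e -integral_cst//.
  apply: eq_integral => x _.
  by rewrite -measureU ?setICr// setUv; exact: prob_kernel.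
apply/eqP; rewrite eq_le sub// andbT.
rewrite -(@leeD2rE _ (p (~` A))); last first.
  rewrite ge0_fin_numE//; apply: le_lt_trans pfin.
  by apply: le_measure; rewrite ?inE//; exact: measurableC.
rewrite -tot leeD2l//; apply: sub; exact: measurableC.
Qed.

Lemma mnormalize_scaleE d (T : measurableType d) (R : realType)
    (p : {measure set T -> \bar R}) (mu : probability T R) (B : set T) :
  p setT != 0%E -> (p setT < +oo)%E ->
  mnormalize p mu B = ((fine (p setT))^-1%:E * p B)%E.
Proof. by move=> p0 pfin; rewrite /mnormalize (negbTE p0) (lt_eqF pfin) muleC. Qed.

Lemma invariant_measure_mnormalize (R : realType) (E : completeMetricType R)
    (P : R -> R.-pker (borel E) ~> (borel E))
    (p : {measure set (borel E) -> \bar R}) (mu : probability (borel E) R) :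
  p setT != 0%E -> (p setT < +oo)%E ->
  (forall t A, 0 <= t -> measurable A -> (\int[p]_x P t x A)%E = p A) ->
  invariant_measure P (mnormalize p mu).
Proof.
move=> p0 pfin ip t A t0 mA.
have c0 : 0 <= (fine (p setT))^-1 by rewrite invr_ge0 fine_ge0.
have -> : (\int[mnormalize p mu]_x P t x A =
           \int[mscale (NngNum c0) p]_x P t x A)%E.
  by apply: eq_measure_integral => B mB _; exact: mnormalize_scaleE.
rewrite ge0_integral_mscale//; last exact: measurable_kernel.
by rewrite ip//; apply/esym; exact: mnormalize_scaleE.
Qed.

Theorem theorem2p8 (R : realType) (E : completeMetricType R)
    (hE : separable E)
    (P : R -> R.-pker (borel E) ~> (borel E)) (hP : markov_semigroup P)
    (F : R -> R) (hF0 : forall r : R, 0 <= r -> 0 <= F r)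
    (hFmono : forall r s : R, 0 <= r -> r <= s -> F r <= F s)
    (hFbnd : (sup_norm [set` `[0%R, +oo[] F < +oo)%E)
    (hirr : locally_weak_irreducible P) (hasf : asf_plus P F)
    (mu nu : probability (borel E) R)
    (hmu : invariant_measure P mu) (hnu : invariant_measure P nu)
    (A : set (borel E)) (hA : measurable A) :
  mu A = nu A.
Proof.
apply: contrapT => munu.
pose sigma : {charge set (borel E) -> \bar R} :=
  cadd (charge_of_finite_measure mu) (copp (charge_of_finite_measure nu)).
have [S [N hSN]] := Hahn_decomposition sigma.
have [[mS _] [mN _] SUN SIN] := hSN.
pose p : {measure set (borel E) -> \bar R} := jordan_pos hSN.
pose q : {measure set (borel E) -> \bar R} := jordan_neg hSN.
have finm (m : probability (borel E) R) B : measurable B -> m B \is a fin_num.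
  by move=> mB; exact: fin_num_measure.
have finp B : measurable B -> p B \is a fin_num.
  by move=> mB; exact: (fin_num_measure (jordan_pos hSN)).
have finq B : measurable B -> q B \is a fin_num.
  by move=> mB; exact: (fin_num_measure (jordan_neg hSN)).
have eqm B : measurable B -> (mu B + q B = nu B + p B)%E.
  move=> mB; have : (mu B - nu B = p B + (- 1)%:E * q B)%E by exact: (jordan_decomp hSN mB).
  move: (finm mu B mB) (finm nu B mB) (finp B mB) (finq B mB).
  case: (mu B) (nu B) (p B) (q B) => [a| |] [b| |] [c| |] [d| |]// _ _ _ _ [abcd].
  by congr EFin; lra.
have pSC : p (~` S) = 0%E.
  apply: etrans (jordan_posE hSN _) _; rewrite cjordan_posE /crestr0 mem_set; last exact: measurableC.
  by rewrite /crestr setICl charge0.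
have qS : q S = 0%E.
  apply: etrans (jordan_negE hSN _) _; rewrite cjordan_negE.
  by rewrite /crestr0 mem_set// /crestr SIN charge0 oppe0.
have pq : q setT = p setT.
  have := eqm _ measurableT.
  have -> : mu setT = 1%E by exact: probability_setT.
  have -> : nu setT = 1%E by exact: probability_setT.
  move: (finp _ measurableT) (finq _ measurableT).
  by case: (p setT) (q setT) => [a| |] [b| |]// _ _ [] /addrI ->.
have pfin : (p setT < +oo)%E by rewrite ltey_eq finp.
have qfin : (q setT < +oo)%E by rewrite pq.
have p0 : p setT != 0%E.
  apply/eqP => pT0; apply: munu.
  have z (m : {measure set (borel E) -> \bar R}) : m setT = 0%E -> m A = 0%E.
    move=> mT0; apply/eqP; rewrite eq_le measure_ge0 andbT -mT0.
    by apply: le_measure; rewrite ?inE.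
  by have := eqm A hA; rewrite (z p)// (z q) ?pq// !adde0.
have q0 : q setT != 0%E by rewrite pq.
have ip := invariant_singular_part hmu hnu mS pfin pSC qS eqm.
have qSCC : q (~` ~` S) = 0%E by rewrite setCK.
have iq := invariant_singular_part hnu hmu (measurableC mS) qfin qSCC pSC
  (fun B mB => esym (eqm B mB)).
apply: (invariant_measure_not_singular hE hF0 hFbnd hirr hasf
  (invariant_measure_mnormalize mu p0 pfin ip)
  (invariant_measure_mnormalize mu q0 qfin iq) mS).
- by apply: etrans (mnormalize_scaleE mu (~` S) p0 pfin) _; rewrite pSC mule0.
- by apply: etrans (mnormalize_scaleE mu S q0 qfin) _; rewrite qS mule0.
Qed.
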